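(* Let $L$ be an LC-loop (respectively, an RC-loop). Then $L$ has the right inverse property (respectively, the left inverse property) if and only if $L$ has the weak inverse property.
   Context: An LC-loop is a loop satisfying $(xx)(yz)=(x(xy))z$ for all $x,y,z$; an RC-loop is a loop satisfying $(zy)(xx)=z((yx)x)$ for all $x,y,z$. In a loop with identity $e$, $x^\lambda$ and $x^\rho$ denote the left and right inverses: $x^\lambda x=e=x\,x^\rho$. The left inverse property is $x^\lambda(xy)=y$ for all $x,y$; the right inverse property is $(yx)x^\rho=y$ for all $x,y$; the weak inverse property is $y(xy)^\rho=x^\rho$ for all $x,y$. *)

(* Defs.v *)
(* A loop as a quasigroup with a two-sided identity, in the equational
   signature: [ldiv a b] is the solution x of [a x = b] and [rdiv b a] is the
   solution y of [y a = b].  The four division laws say exactly that these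
   solutions exist and are unique. *)
Record loop : Type := Loop {
  carrier :> Type;
  op : carrier -> carrier -> carrier;
  ldiv : carrier -> carrier -> carrier;
  rdiv : carrier -> carrier -> carrier;
  neutral : carrier;
  op_ldiv : forall a b, op a (ldiv a b) = b;
  ldiv_op : forall a x, ldiv a (op a x) = x;
  rdiv_op : forall y a, rdiv (op y a) a = y;
  op_rdiv : forall b a, op (rdiv b a) a = b;
  neutral_op : forall x, op neutral x = x;
  op_neutral : forall x, op x neutral = x
}.

Arguments op {l} _ _.
Arguments ldiv {l} _ _.
Arguments rdiv {l} _ _.
Arguments neutral {l}.

Declare Scope loop_scope.
Delimit Scope loop_scope with loop.
Notation "x * y" := (op x y) : loop_scope.
Local Open Scope loop_scope.

Definition linv {L : loop} (x : L) : L := rdiv neutral x.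
Definition rinv {L : loop} (x : L) : L := ldiv x neutral.

Lemma linv_op (L : loop) (x : L) : linv x * x = neutral.
Proof. exact (op_rdiv L neutral x). Qed.

Lemma op_rinv (L : loop) (x : L) : x * rinv x = neutral.
Proof. exact (op_ldiv L x neutral). Qed.

Definition LC_loop (L : loop) : Prop :=
  forall x y z : L, (x * x) * (y * z) = (x * (x * y)) * z.

Definition RC_loop (L : loop) : Prop :=
  forall x y z : L, (z * y) * (x * x) = z * ((y * x) * x).

Definition left_inverse_property (L : loop) : Prop :=
  forall x y : L, linv x * (x * y) = y.

Definition right_inverse_property (L : loop) : Prop :=
  forall x y : L, (y * x) * rinv x = y.

Definition weak_inverse_property (L : loop) : Prop :=
  forall x y : L, y * rinv (x * y) = rinv x.

(* Main.v *)
Require Import Defs.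

(** The theorem splits into two independent facts.  First, any two of the left
    inverse, right inverse and weak inverse properties imply the third
    ([left_right_weak], [left_weak_right], [right_weak_left]); for instance,
    the weak inverse law at the pair [linv y], [y * x] becomes the right
    inverse law once the left inverse property simplifies
    [linv y * (y * x)] to [x].  Secondly, an LC-loop always has the left
    inverse property and an RC-loop the right one ([LC_left_inverse],
    [RC_right_inverse]), so one of the three properties is there from the
    start and the other two become equivalent. *)

Local Open Scope loop_scope.

Section InverseProperties.

Variable L : loop.
Implicit Types a x y z : L.

Lemma op_cancel_l a x y : a * x = a * y -> x = y.
Proof.
  intro H. rewrite <- (ldiv_op L a x), H. apply ldiv_op.
Qed.

Lemma op_cancel_r a x y : x * a = y * a -> x = y.
Proof.
  intro H. rewrite <- (rdiv_op L x a), H. apply rdiv_op.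
Qed.

Lemma rinv_linv x : rinv (linv x) = x.
Proof.
  apply (op_cancel_l (linv x)). now rewrite op_rinv, linv_op.
Qed.

(** Both sides are values of [(linv x * x) * rinv x]. *)
Lemma right_inverse_linv_rinv x : right_inverse_property L -> linv x = rinv x.
Proof.
  intro R. rewrite <- (R x (linv x)), linv_op. apply neutral_op.
Qed.

(** The left inverse property writes [y] as [linv x * (x * y)], and the right
    inverse property then cancels [x * y] against [rinv (x * y)]. *)
Lemma left_right_weak :
  left_inverse_property L -> right_inverse_property L ->
  weak_inverse_property L.
Proof.
  intros I R x y.
  generalize (R (x * y) (linv x)).
  now rewrite I, (right_inverse_linv_rinv x R).
Qed.

Lemma left_weak_right :
  left_inverse_property L -> weak_inverse_property L ->
  right_inverse_property L.
Proof.
  intros I W x y.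
  generalize (W (linv y) (y * x)). now rewrite I, rinv_linv.
Qed.

(** The weak inverse law says that [y * rinv (x * y)] is [rinv x]; the right
    inverse property recovers [y] from it by multiplying by the inverse of
    [rinv (x * y)], which is [x * y] because left and right inverses agree. *)
Lemma right_weak_left :
  right_inverse_property L -> weak_inverse_property L ->
  left_inverse_property L.
Proof.
  intros R W x y.
  generalize (R (rinv (x * y)) y).
  rewrite W, (right_inverse_linv_rinv x R).
  now rewrite <- (right_inverse_linv_rinv (x * y) R), rinv_linv.
Qed.

(** The LC law at [z = neutral] is the left alternative law, which turns the
    LC law into [a * (a * (y * z)) = (a * (a * y)) * z].  At [a = linv x] and
    [y = x] the right-hand side collapses to [linv x * z], and cancelling
    [linv x] on the left gives the left inverse property. *)
Lemma LC_left_inverse : LC_loop L -> left_inverse_property L.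
Proof.
  intro C.
  assert (alt : forall x y, (x * x) * y = x * (x * y)).
  { intros x y. generalize (C x y neutral). now rewrite !op_neutral. }
  intros x y. apply (op_cancel_l (linv x)).
  generalize (C (linv x) x y). rewrite alt, linv_op.
  now rewrite op_neutral.
Qed.

(** The mirror image of [LC_left_inverse]. *)
Lemma RC_right_inverse : RC_loop L -> right_inverse_property L.
Proof.
  intro C.
  assert (alt : forall x y, y * (x * x) = (y * x) * x).
  { intros x y. generalize (C x y neutral). now rewrite !neutral_op. }
  intros x y. apply (op_cancel_r (rinv x)).
  generalize (C (rinv x) x y). rewrite alt, op_rinv.
  now rewrite neutral_op.
Qed.

End InverseProperties.

Theorem theorem6p2 :
  forall L : loop,
    (LC_loop L -> (right_inverse_property L <-> weak_inverse_property L)) /\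
    (RC_loop L -> (left_inverse_property L <-> weak_inverse_property L)).
Proof.
  intro L. split; intro C.
  - pose proof (LC_left_inverse L C) as I. split; intro H.
    + now apply left_right_weak.
    + now apply left_weak_right.
  - pose proof (RC_right_inverse L C) as R. split; intro H.
    + now apply left_right_weak.
    + now apply right_weak_left.
Qed.
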